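(* Define polynomials $A_n \in \mathbb{Z}[x_1, x_2, \dotsc]$ for $n \geq 1$ by $A_1 = x_1$ and $A_n = \mathcal{D} A_{n-1}$ for $n \geq 2$, where $$\mathcal{D} = \sum_{i=1}^\infty x_{i+1} \frac{\partial}{\partial x_i} + \sum_{i,j \geq 1} x_1 x_i x_j \frac{\partial}{\partial x_{i+j}},$$ and let $\mathcal{A}(\lambda) = \sum_{n=0}^\infty A_{n+1} \frac{\lambda^n}{n!}$. For $n \geq 1$ let $$L_n = \sum_{p \vdash n} Z_{\mathfrak{S}}(p) \prod_{i=1}^n x_i^{p(i)},$$ where the sum is over all partitions $p$ of $n$, $p(i)$ is the multiplicity of $i$ as a part of $p$, and $Z_{\mathfrak{S}}(p)$ is the number of permutations of $[n+1]$ whose run structure is $p$; and let $L_0 = 1$. Then for every $n \geq 1$, $$L_n = \sum_{p \vdash n} \frac{2^{|p|}}{\operatorname{ord} p} \binom{n}{p} \prod_{i=1}^{|p|} A_{p_i},$$ where the sum is over all partitions $p = p_1 + p_2 + \dotsb + p_{|p|}$ of $n$. Moreover, as formal power series in $\lambda$, $$\mathcal{L}(\lambda) := \sum_{n=0}^\infty L_n \frac{\lambda^n}{n!} = \exp\left( 2 \int_0^\lambda \mathcal{A}(\mu)\, d\mu \right).$$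
   Context: Write $[m] = \{1, \dotsc, m\}$; a permutation of $[m]$ is a word $\sigma = \sigma_1 \cdots \sigma_m$ using each element of $[m]$ exactly once. A run of a permutation $\sigma$ of $[m]$ is an integer interval $\{i, i+1, \dotsc, j\} \subseteq [m]$ with $i<j$ such that $\sigma(i), \sigma(i+1), \dotsc, \sigma(j)$ is a monotone sequence (increasing or decreasing) and such that the interval cannot be extended in either direction with this property; its length is $j - i$. The lengths of all runs of $\sigma$ form a partition of $m-1$, called the run structure of $\sigma$. For a partition $p = p_1 + p_2 + \dotsb$ of $n$, $|p|$ is the number of parts of $p$; $\operatorname{ord} p = \prod_i p(i)!$ is the symmetry order of the parts, $p(i)$ being the multiplicity of $i$ in $p$ (e.g. for $p = 1+1+2+3+3$, $\operatorname{ord} p = 2!\,2!$); and $\binom{n}{p} = \frac{n!}{p_1!\, p_2! \cdots p_{|p|}!}$ is the multinomial coefficient. The operator $\mathcal{D}$ is a formal infinite sum acting on polynomials in the variables $x_1, x_2, \dotsc$; on each polynomial only finitely many terms are nonzero. The integral of a formal power series is taken term by term: $\int_0^\lambda \mathcal{A}(\mu)\, d\mu = \sum_{n=1}^\infty A_n \frac{\lambda^n}{n!}$. *)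

(* Defs.v *)
From HB Require Import structures.
From mathcomp Require Import all_boot all_order all_algebra all_fingroup.
From mathcomp Require Import finmap.
From mathcomp Require Import boolp classical_sets cardinality fsbigop.
From mathcomp.multinomials Require Import monalg.

Set Implicit Arguments.
Unset Strict Implicit.
Unset Printing Implicit Defensive.

Import Order.TTheory GRing.Theory Num.Theory.

Local Open Scope ring_scope.

(** ** Partitions of an integer *)

Definition is_partition (n : nat) (p : seq nat) : bool :=
  [&& sorted geq p, 0%N \notin p & sumn p == n].

Record intpart (n : nat) := IntPart {
  parts :> seq nat;
  partsP : is_partition n parts
}.

HB.instance Definition _ n := [isSub for @parts n].
HB.instance Definition _ n := [Countable of intpart n by <:].

Lemma partition_bounds (n : nat) (p : seq nat) : is_partition n p ->
  (size p <= n)%N /\ {in p, forall i, (i <= n)%N}.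
Proof.
move=> /and3P[_ p0 /eqP <-]; elim: p p0 => [|a p IH] //=.
rewrite in_cons negb_or eq_sym => /andP[a0 /IH[szp lep]]; split.
  by rewrite -add1n leq_add // lt0n.
move=> i; rewrite in_cons => /orP[/eqP ->|/lep ip]; first exact: leq_addr.
exact: leq_trans ip (leq_addl _ _).
Qed.

Section IntpartFinite.
Variable n : nat.

Let code (p : intpart n) : n.-bseq 'I_n.+1 :=
  insub_bseq n [seq inord i | i <- parts p].
Let decode (b : n.-bseq 'I_n.+1) : option (intpart n) :=
  insub [seq val i | i <- b].

Lemma intpart_codeK : pcancel code decode.
Proof.
move=> p; have [szp lep] := partition_bounds (partsP p).
rewrite /decode /code /insub_bseq val_insubd size_map szp -map_comp.
have -> : [seq (val \o @inord n) i | i <- parts p] = p :> seq nat.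
  by apply: map_id_in => i ip /=; rewrite inordK // ltnS lep.
by rewrite (insubT (is_partition n) (partsP p)); congr Some; apply: val_inj.
Qed.

HB.instance Definition _ :=
  isFinite.Build (intpart n) (pcan_enumP intpart_codeK).

End IntpartFinite.

Definition sym_ord (n : nat) (p : intpart n) : nat :=
  (\prod_(1 <= i < n.+1) (count_mem i p)`!)%N.

Definition multinom (n : nat) (p : intpart n) : rat :=
  n`!%:R / \prod_(a <- p) a`!%:R.

(** ** Runs of permutations

  Positions and values of a permutation of [m] are shifted down by one, so that
  permutations of [m] are elements of ['S_m]. *)

Definition monotone_between (m : nat) (s : 'S_m) (i j : 'I_m) : bool :=
  [forall a : 'I_m, forall b : 'I_m,
     [&& i <= a, a < b & b <= j]%N ==> (s a < s b)%N]
  || [forall a : 'I_m, forall b : 'I_m,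
     [&& i <= a, a < b & b <= j]%N ==> (s b < s a)%N].

Definition is_run (m : nat) (s : 'S_m) (ij : 'I_m * 'I_m) : bool :=
  [&& (ij.1 < ij.2)%N, monotone_between s ij.1 ij.2 &
    [forall i' : 'I_m, forall j' : 'I_m,
      [&& i' <= ij.1, ij.2 <= j' & monotone_between s i' j']%N
        ==> (i' == ij.1) && (j' == ij.2)]].

Definition run_structure (m : nat) (s : 'S_m) : seq nat :=
  sort geq [seq (ij.2 - ij.1)%N | ij : 'I_m * 'I_m in is_run s].

Definition Z_S (n : nat) (p : intpart n) : nat :=
  #|[set s : 'S_n.+1 | run_structure s == p :> seq nat]|.

(** ** Polynomials in the variables x_1, x_2, ...

  The variable x_i, for i >= 1, is the generator of index [i.-1], so that the
  ring has no spurious variable x_0; indices of [x_] and [pderiv] are always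
  positive. *)

Notation polyX R := {malg R[{cmonom nat}]}.

Definition x_ {R : comNzRingType} (i : nat) : polyX R := << ucm i.-1 >>.

Definition pderiv {R : comNzRingType} (i : nat) (P : polyX R) : polyX R :=
  \sum_(m <- msupp P) << P@_m *+ m i.-1 *g divcm m (ucm i.-1) >>.

(* The sums have finite support by [pderiv_finite] and [pderiv_add_finite]
   below. *)
Definition opD {R : comNzRingType} (P : polyX R) : polyX R :=
  \sum_(i \in [set i : nat | (1 <= i)%N]%classic) (x_ i.+1 * pderiv i P)
  + \sum_(ij \in [set ij : nat * nat | (1 <= ij.1)%N /\ (1 <= ij.2)%N]%classic)
      (x_ 1 * x_ ij.1 * x_ ij.2 * pderiv (ij.1 + ij.2)%N P).

Lemma pderiv_bounded (R : comNzRingType) (P : polyX R) :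
  exists N, forall i, (N <= i)%N -> pderiv i P = 0.
Proof.
exists (\max_(m <- msupp P) \max_(k <- finsupp (cmonom_val m)) k.+2)%N => i lei.
rewrite /pderiv big_seq big1 // => m mP.
suff -> : m i.-1 = 0%N by rewrite mulr0n monalgU0.
apply/eqP; rewrite cmE_eq0; apply/negP => im.
have: (i.-1.+2 <= i)%N.
  apply: leq_trans lei; apply: leq_trans (leq_bigmax_seq _ mP isT).
  exact: (@leq_bigmax_seq nat _ xpredT (fun k => k.+2) _ im isT).
by case: i {lei im} => // i; rewrite ltnn.
Qed.

Lemma pderiv_finite (R : comNzRingType) (P : polyX R) :
  finite_set [set i | pderiv i P != 0]%classic.
Proof.
have [N PN] := pderiv_bounded P.
apply: (sub_finite_set _ (finite_II N)) => i /= Pi.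
by rewrite ltnNge; apply: contra Pi => /PN ->.
Qed.

Lemma pderiv_add_finite (R : comNzRingType) (P : polyX R) :
  finite_set [set ij : nat * nat | pderiv (ij.1 + ij.2)%N P != 0]%classic.
Proof.
have [N PN] := pderiv_bounded P.
apply: (sub_finite_set _ (finite_setX (finite_II N) (finite_II N))) => -[i j] /= Pi.
have lt : (i + j < N)%N by rewrite ltnNge; apply: contra Pi => /PN ->.
by split; apply: leq_ltn_trans lt; rewrite ?leq_addr ?leq_addl.
Qed.

(* Meaningful for n >= 1 only. *)
Definition A_ (n : nat) : polyX int := iter n.-1 opD (x_ 1).

Definition L_ (n : nat) : polyX int :=
  if n is 0 then 1 else
  \sum_(p : intpart n) (Z_S p)%:R * \prod_(1 <= i < n.+1) x_ i ^+ count_mem i p.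

Definition toQ (P : polyX int) : polyX rat :=
  [malg m in msupp P => (P@_m)%:~R].

(** ** Formal power series, given by their sequences of coefficients *)

Definition fps (R : Type) := nat -> R.

Section FormalPowerSeries.
Variable R : comAlgType rat.
Implicit Types f g : fps R.

Definition fps_one : fps R := fun n => (n == 0%N)%:R.

Definition fps_scale (c : rat) f : fps R := fun n => c *: f n.

Definition fps_mul f g : fps R := fun n => \sum_(i < n.+1) f i * g (n - i)%N.

Definition fps_pow f (k : nat) : fps R := iter k (fps_mul f) fps_one.

Definition fps_int f : fps R :=
  fun n => if n is m.+1 then m.+1%:R^-1 *: f m else 0.

(* The series sum_k f^k / k! for f with zero constant coefficient: the terms
   with k > n do not contribute to the coefficient of index n. *)
Definition fps_exp f : fps R :=
  fun n => \sum_(k < n.+1) (k`!%:R^-1 : rat) *: fps_pow f k n.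

End FormalPowerSeries.

Definition calA : fps (polyX rat) := fun n => (n`!%:R^-1 : rat) *: toQ (A_ n.+1).

Definition calL : fps (polyX rat) := fun n => (n`!%:R^-1 : rat) *: toQ (L_ n).

(* Main.v *)
(* [D] is a derivation.  The ascent word of a permutation determines its run
   structure, and inserting a new minimum replaces one letter of that word by
   "descent, ascent", or adds an ascent in front or a descent at the end.
   Summing over all positions gives [L_(n+1) = D L_n + 2 x_1 L_n]; since [D] is
   a derivation, Leibniz and Pascal turn this into
   [L_(n+1) = 2 sum_k 'C(n, k) A_(k+1) L_(n-k)], that is [L' = 2 A L].  The
   exponential series and the sum over partitions (count each partition by one
   of its marked parts) satisfy the same recurrence. *)
From HB Require Import structures.
From mathcomp Require Import all_boot all_order all_algebra all_fingroup.
From mathcomp Require Import finmap.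
From mathcomp Require Import classical_sets fsbigop.
From mathcomp Require Import ring zify.
From mathcomp.multinomials Require Import monalg.
Require Import Defs.

Set Implicit Arguments.
Unset Strict Implicit.
Unset Printing Implicit Defensive.

Import Order.TTheory GRing.Theory Num.Theory.

Local Open Scope ring_scope.

(** * Derivations on monoid algebras *)

(** Both sides are biadditive, so the product rule only has to be checked on pairs of summands; it
    is applied to the monomial expansions of two polynomials. *)
Lemma leibniz_sum (S : pzRingType) (f : S -> S) (I J : Type)
    (s : seq I) (t : seq J) (F : I -> S) (G : J -> S) :
  additive f -> (forall i j, f (F i * G j) = f (F i) * G j + F i * f (G j)) ->
  let P := \sum_(i <- s) F i in let Q := \sum_(j <- t) G j in
  f (P * Q) = f P * Q + P * f Q.
Proof.
move=> fA fM P Q; rewrite {}/P {}/Q.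
pose f' : {additive S -> S} := HB.pack f (GRing.isZmodMorphism.Build S S f fA).
have fS K (r : seq K) (H : K -> S) : f (\sum_(k <- r) H k) = \sum_(k <- r) f (H k).
  exact: (raddf_sum f').
rewrite !mulr_suml !fS mulr_suml -big_split /=.
apply: eq_bigr => i _; rewrite !mulr_sumr fS -big_split /=.
exact: eq_bigr.
Qed.

Section MonomialDerivation.
Variables (K : conomType) (R : comNzRingType) (e : K -> nat) (d : K -> K).
Implicit Types (P Q : {malg R[K]}).

(** Common shape of the partial derivatives: [e m] is the exponent of the chosen variable in [m],
    and [d m] is [m] with that exponent lowered by one. *)
Definition monomial_der P : {malg R[K]} :=
  \sum_(m <- msupp P) << P@_m *+ e m *g d m >>.

Lemma monomial_derEw (s : {fset K}) P : (msupp P `<=` s)%fset ->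
  monomial_der P = \sum_(m <- s) << P@_m *+ e m *g d m >>.
Proof.
move=> le; rewrite /monomial_der (big_fset_incl _ le) //= => m _ /mcoeff_outdom ->.
by rewrite mul0rn monalgU0.
Qed.

Lemma monomial_derU c m :
  monomial_der << c *g m >> = << c *+ e m *g d m >>.
Proof. by rewrite (monomial_derEw msuppU_le) big_seq_fset1 mcoeffUU. Qed.

Lemma monomial_der_eq0 m : e m = 0%N -> monomial_der << m >> = 0.
Proof. by move=> e0; rewrite monomial_derU e0 monalgU0. Qed.

Lemma monomial_der_eq1 m : e m = 1%N -> d m = mone -> monomial_der << m >> = 1.
Proof. by move=> e1 d1; rewrite monomial_derU e1 d1 mpolyC1E. Qed.

Lemma monomial_der_is_additive : additive monomial_der.
Proof.
move=> P Q; pose s := (msupp P `|` msupp Q)%fset.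
rewrite !(@monomial_derEw s) ?fsubsetUl ?fsubsetUr ?msuppB_le // -sumrB.
by apply: eq_bigr => m _; rewrite mcoeffB mulrnBl monalgUB.
Qed.

Hypothesis eM : forall k l, e (mmul k l) = (e k + e l)%N.
Hypothesis dMl : forall k l, e k != 0%N -> d (mmul k l) = mmul (d k) l.

(** On two monomials the factor [e k + e l] splits into the two terms of the rule. Lowering an
    exponent is truncated, so [d] is compatible with products only at a nonzero exponent; at
    exponent 0 the term vanishes through its coefficient. *)
Lemma monomial_derM P Q :
  monomial_der (P * Q) = monomial_der P * Q + P * monomial_der Q.
Proof.
rewrite [P]monalgE [Q]monalgE; apply: leibniz_sum.
  exact: monomial_der_is_additive.
move=> k l; move: P@_k Q@_l => a b.
have mulUU (c1 c2 : R) (k1 k2 : K) :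
  << c1 *g k1 >> * << c2 *g k2 >> = << c1 * c2 *g mmul k1 k2 >> :> {malg R[K]}.
  exact: fgmulUU.
rewrite mulUU 3!monomial_derU 2!mulUU eM mulrnDr monalgUD -mulrnAl -mulrnAr.
congr (_ + _).
- have [->|k0] := eqVneq (e k) 0%N; first by rewrite mulr0n mul0r !monalgU0.
  by rewrite dMl.
- have [->|l0] := eqVneq (e l) 0%N; first by rewrite mulr0n mulr0 !monalgU0.
  by rewrite mulmC dMl // mulmC.
Qed.

End MonomialDerivation.

Lemma fsbig_seq_eq (S : nmodType) (I : choiceType) (A : set I) (r : seq I) (F : I -> S) :
  uniq r -> (forall i, i \in r -> A i) -> (forall i, A i -> i \notin r -> F i = 0) ->
  \sum_(i \in A) F i = \sum_(i <- r) F i.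
Proof.
move=> ur rA F0; rewrite (fsbigE r) //.
rewrite big_seq_cond [RHS]big_seq; apply: eq_bigl => i.
by case ir: (i \in r) => //=; rewrite mem_set //; exact: rA.
Qed.

(** * Partial derivatives and the operator D *)

Section PartialDerivatives.
Variable R : comNzRingType.
Implicit Types (P Q : polyX R) (i : nat).

Lemma pderiv_is_additive i : additive (@pderiv R i).
Proof. exact: (@monomial_der_is_additive {cmonom nat} R). Qed.

Lemma pderivM i P Q : pderiv i (P * Q) = pderiv i P * Q + P * pderiv i Q.
Proof.
apply: (@monomial_derM {cmonom nat} R (fun m => m i.-1) (fun m => divcm m (ucm i.-1))).
  by move=> k l; exact: cmM.
move=> k l k0; apply/eqP/cmP => j; rewrite divcmE !cmM divcmE cmU.
by case: eqVneq => [<-|]; rewrite ?subn0 // addnBAC // lt0n.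
Qed.

Lemma pderiv_x i j : (0 < i)%N -> (0 < j)%N -> pderiv i (x_ j) = (i == j)%:R :> polyX R.
Proof.
move=> i0 j0.
pose e (m : {cmonom nat}) : nat := m i.-1; pose d m := divcm m (ucm i.-1).
have ej : e (ucm j.-1) = (i == j).
  by rewrite /e cmU; case: i j i0 j0 {e d} => [|i] [|j] //= _ _; rewrite eqSS eq_sym.
case: eqP ej => [<-|_] ej.
  apply: (@monomial_der_eq1 {cmonom nat} R e d) => //.
  by apply/eqP/cmP => k; rewrite divcmE subnn cm1.
exact: (@monomial_der_eq0 {cmonom nat} R e d).
Qed.

(** A pair of positive indices outside the square of side [N] has sum at least [N], so its
    derivative vanishes. Polynomials with a common bound [N] thus share one finite expression for
    [opD]. *)
Lemma opDEw N P : (forall i, (N <= i)%N -> pderiv i P = 0) ->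
  opD P = \sum_(1 <= i < N.+1) x_ i.+1 * pderiv i P
    + \sum_(ij <- allpairs pair (index_iota 1 N.+1) (index_iota 1 N.+1))
        x_ 1 * x_ ij.1 * x_ ij.2 * pderiv (ij.1 + ij.2) P.
Proof.
move=> PN; rewrite /opD; congr (_ + _).
  apply: fsbig_seq_eq; first exact: iota_uniq.
    by move=> i; rewrite mem_index_iota => /andP[].
  move=> i /= i1; rewrite mem_index_iota i1 /= -leqNgt => /ltnW /PN ->.
  by rewrite mulr0.
apply: fsbig_seq_eq => [||[i j] /= [i1 j1] nij].
- by rewrite allpairs_uniq ?iota_uniq // => -[? ?] [? ?] _ _ /= [-> ->].
- by move=> ij /allpairsP[[i j] /= [+ + ->]] /=; rewrite !mem_index_iota => /andP[-> _] /andP[-> _].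
rewrite PN ?mulr0 //.
have {nij} : ~~ ((i < N.+1)%N && (j < N.+1)%N).
  apply: contra nij => /andP[iN jN]; apply/allpairsP; exists (i, j).
  by rewrite !mem_index_iota i1 j1 iN jN.
lia.
Qed.

End PartialDerivatives.

Section KroneckerSums.
Variables (S : comPzRingType) (l N : nat) (delta : nat -> S).
Hypotheses (l0 : (0 < l)%N) (lN : (l <= N)%N).
Hypothesis deltaE : forall k, (0 < k)%N -> delta k = (k == l)%:R.

Lemma sum_delta (c : nat -> S) : \sum_(1 <= i < N.+1) c i * delta i = c l.
Proof.
rewrite (bigD1_seq l) ?iota_uniq ?mem_index_iota ?l0 //=.
rewrite deltaE // eqxx mulr1 big_seq_cond big1 ?addr0 // => i.
rewrite mem_index_iota => /andP[/andP[i0 _] il].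
by rewrite deltaE // (negPf il) mulr0.
Qed.

(** Only the antidiagonal [i + j = l] survives, which forces [i < l] and [j = l - i]. The sequence
    [delta] stands for the derivatives of [x_ l], which are Kronecker symbols at positive
    indices. *)
Lemma sum_delta_add (c : nat -> nat -> S) :
  \sum_(1 <= i < N.+1) \sum_(1 <= j < N.+1) c i j * delta (i + j) =
  \sum_(1 <= j < l) c j (l - j)%N.
Proof.
rewrite (big_cat_nat (n := l)) //=; last exact: leqW.
rewrite [X in _ + X]big_nat_cond [X in _ + X]big1 ?addr0; last first.
  move=> i /andP[/andP[li _] _]; rewrite big_nat_cond big1 // => j /andP[/andP[j0 _] _].
  by rewrite deltaE ?addn_gt0 ?j0 ?orbT // gtn_eqF ?mulr0 //; lia.
apply: eq_big_nat => i /andP[i0 il].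
rewrite (bigD1_seq (l - i)%N) ?iota_uniq ?mem_index_iota /=; [|lia|by []].
rewrite deltaE ?subnKC ?eqxx ?mulr1 //; [|exact: ltnW..].
rewrite big_nat_cond big1 ?addr0 // => j /andP[/andP[j0 _] jl].
rewrite deltaE ?addn_gt0 ?i0 //.
by case: eqP => [E|_]; [move: jl; rewrite -E addKn eqxx|rewrite mulr0].
Qed.

End KroneckerSums.

Section TwoSums.
Variables (S : comPzRingType) (I J : Type) (r : seq I) (s : seq J).
Variables (c : I -> S) (f : I -> S -> S) (d : J -> S) (g : J -> S -> S).

(** The shape of the truncated [opD]: a combination, with ring coefficients, of maps that are
    derivations, hence itself a derivation. *)
Let D P := \sum_(i <- r) c i * f i P + \sum_(j <- s) d j * g j P.

Lemma sum_der_additive :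
  (forall i, additive (f i)) -> (forall j, additive (g j)) -> additive D.
Proof.
move=> fD gD P Q; rewrite /D opprD addrACA -!sumrB.
by congr (_ + _); apply: eq_bigr => i _; rewrite ?fD ?gD mulrBr.
Qed.

Lemma sum_der_leibniz P Q :
  (forall i, f i (P * Q) = f i P * Q + P * f i Q) ->
  (forall j, g j (P * Q) = g j P * Q + P * g j Q) ->
  D (P * Q) = D P * Q + P * D Q.
Proof.
move=> fM gM; rewrite /D mulrDl mulrDr addrACA !mulr_suml !mulr_sumr -!big_split /=.
by congr (_ + _); apply: eq_bigr => i _;
  rewrite ?fM ?gM mulrDr mulrA [P * (_ * _)]mulrCA.
Qed.

End TwoSums.

Section OperatorD.
Variable R : comNzRingType.
Implicit Types (P Q : polyX R).

Lemma pderiv_bounded2 P Q : exists N, forall i, (N <= i)%N -> pderiv i P = 0 /\ pderiv i Q = 0.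
Proof.
have [N PN] := pderiv_bounded P; have [M QM] := pderiv_bounded Q.
by exists (maxn N M) => i; rewrite geq_max => /andP[/PN -> /QM ->].
Qed.

Lemma opD_is_additive : additive (@opD R).
Proof.
move=> P Q; have [N PQN] := pderiv_bounded2 P Q.
pose I := index_iota 1 N.+1; pose J := allpairs pair I I.
have E (T : polyX R) : (forall i, (N <= i)%N -> pderiv i T = 0) ->
  opD T = \sum_(i <- I) x_ i.+1 * pderiv i T
    + \sum_(ij <- J) x_ 1 * x_ ij.1 * x_ ij.2 * pderiv (ij.1 + ij.2) T.
  exact: opDEw.
rewrite (E P); last by move=> i /PQN[].
rewrite (E Q); last by move=> i /PQN[].
rewrite (E (P - Q)); last first.
  by move=> i /PQN[P0 Q0]; rewrite (pderiv_is_additive i) P0 Q0 subr0.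
apply: (@sum_der_additive (polyX R) _ _ I J (fun i => x_ i.+1) (fun i => pderiv i)
  (fun ij => x_ 1 * x_ ij.1 * x_ ij.2) (fun ij => pderiv (ij.1 + ij.2))).
  by move=> i; exact: pderiv_is_additive.
by move=> i; exact: pderiv_is_additive.
Qed.

Lemma opDM P Q : opD (P * Q) = opD P * Q + P * opD Q.
Proof.
have [N PQN] := pderiv_bounded2 P Q.
pose I := index_iota 1 N.+1; pose J := allpairs pair I I.
have E (T : polyX R) : (forall i, (N <= i)%N -> pderiv i T = 0) ->
  opD T = \sum_(i <- I) x_ i.+1 * pderiv i T
    + \sum_(ij <- J) x_ 1 * x_ ij.1 * x_ ij.2 * pderiv (ij.1 + ij.2) T.
  exact: opDEw.
rewrite (E P); last by move=> i /PQN[].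
rewrite (E Q); last by move=> i /PQN[].
rewrite (E (P * Q)); last first.
  by move=> i /PQN[P0 Q0]; rewrite pderivM P0 Q0 mul0r mulr0 addr0.
apply: (@sum_der_leibniz (polyX R) _ _ I J (fun i => x_ i.+1) (fun i => pderiv i)
  (fun ij => x_ 1 * x_ ij.1 * x_ ij.2) (fun ij => pderiv (ij.1 + ij.2))).
  by move=> i; exact: pderivM.
by move=> i; exact: pderivM.
Qed.

(** The values on the variables, together with additivity and the Leibniz rule, are all that the
    combinatorial argument uses about [opD]. *)
Lemma opDx l : (0 < l)%N ->
  opD (x_ l) = x_ l.+1 + \sum_(1 <= j < l) x_ 1 * x_ j * x_ (l - j) :> polyX R.
Proof.
move=> l0; have xE k : (0 < k)%N -> pderiv k (x_ l) = (k == l)%:R :> polyX R.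
  by move=> k0; exact: pderiv_x.
rewrite (@opDEw R l.+1) => [|i li]; last first.
  by rewrite pderiv_x ?(leq_trans _ li) // gtn_eqF.
rewrite big_allpairs; apply: f_equal2.
  exact: (@sum_delta (polyX R) _ _ _ l0 (leqnSn l) xE (fun i => x_ i.+1)).
exact: (@sum_delta_add (polyX R) _ _ _ l0 (leqnSn l) xE (fun i j => x_ 1 * x_ i * x_ j)).
Qed.

End OperatorD.

(** * Run lengths of ascent words under insertion of a minimum *)

(** The accumulator [l] is the length of the run being read, whose letters are all [c]. *)
Fixpoint run_lengths_from (l : nat) (c : bool) (b : bitseq) : seq nat :=
  if b is d :: b' then
    if d == c then run_lengths_from l.+1 c b' else l :: run_lengths_from 1 d b'
  else [:: l].

Definition run_lengths (b : bitseq) : seq nat :=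
  if b is c :: b' then run_lengths_from 1 c b' else [::].

Fixpoint bit_splits (b : bitseq) : seq bitseq :=
  if b is c :: b' then [:: false, true & b'] :: map (cons c) (bit_splits b') else [::].

(** The list is ordered by the position of the new minimum: entry [i] of the list is the word
    obtained by inserting at position [i]. *)
Definition min_insertions (b : bitseq) : seq bitseq :=
  (true :: b) :: rcons (bit_splits b) (rcons b false).

Section RunMonomials.
Variables (S : comNzRingType) (x : nat -> S) (D : S -> S).
Hypotheses (DD : additive D) (DM : forall P Q, D (P * Q) = D P * Q + P * D Q).
Hypothesis Dx : forall l, (0 < l)%N ->
  D (x l) = x l.+1 + \sum_(1 <= j < l) x 1 * x j * x (l - j).

Lemma leibniz1 : D 1 = 0.
Proof. by apply: (addrI (D 1)); have := DM 1 1; rewrite !(mulr1, mul1r) addr0. Qed.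

Definition run_monomial (b : bitseq) : S := \prod_(a <- run_lengths b) x a.

(** The monomial of [b] preceded by an open run of [l] letters [c]. *)
Let W l c b : S := \prod_(a <- run_lengths_from l c b) x a.

Let W0 l c : W l c [::] = x l.
Proof. exact: big_seq1. Qed.

Let Weq l c b : W l c (c :: b) = W l.+1 c b.
Proof. by rewrite /W /= eqxx. Qed.

Let Wneq l c d b : d != c -> W l c (d :: b) = x l * W 1 d b.
Proof. by move=> dc; rewrite /W /= (negPf dc) big_cons. Qed.

(** Contribution of the insertions that leave the letters of the open run untouched. *)
Let tail l c b : S := \sum_(b' <- bit_splits b) W l c b' + W l c (rcons b false).

Let tail0 l c : tail l c [::] = W l c [:: false].
Proof. by rewrite /tail big_nil add0r. Qed.

Let tail_eq l c b : tail l c (c :: b) = W l c [:: false, true & b] + tail l.+1 c b.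
Proof.
rewrite /tail /= big_cons big_map Weq -addrA; congr (_ + (_ + _)).
by apply: eq_bigr => b' _; rewrite Weq.
Qed.

Let tail_neq l c d b : d != c ->
  tail l c (d :: b) = W l c [:: false, true & b] + x l * tail 1 d b.
Proof.
move=> dc; rewrite /tail /= big_cons big_map (Wneq _ _ dc) mulrDr mulr_sumr -addrA.
by congr (_ + (_ + _)); apply: eq_bigr => b' _; rewrite (Wneq _ _ dc).
Qed.

(** Contribution of the insertions that cut the open run into lengths [j] and [l - j], separated by
    a run of length 1 in the opposite direction. These are the products in [D (x l)]. *)
Let split l c b : S := \sum_(1 <= j < l) x j * x 1 * W (l - j) c b.

Let split_neq l c d b : (0 < l)%N -> d != c ->
  split l c (d :: b) = (D (x l) - x l.+1) * W 1 d b.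
Proof.
move=> l0 dc; rewrite /split Dx // addrC addKr mulr_suml; apply: eq_bigr => j _.
by rewrite Wneq // mulrA [x 1 * x j]mulrC.
Qed.

Let split0 l c : (0 < l)%N -> split l c [::] = D (x l) - x l.+1.
Proof.
move=> l0; rewrite /split Dx // addrC addKr; apply: eq_bigr => j _.
by rewrite W0 [x 1 * x j]mulrC.
Qed.

Let splitS l c b : (0 < l)%N ->
  split l.+1 c b = split l c (c :: b) + x l * x 1 * W 1 c b.
Proof.
move=> l0; rewrite /split big_nat_recr //= subSnn; congr (_ + _).
by apply: eq_big_nat => j /andP[_ jl]; rewrite Weq subSn // ltnW.
Qed.

(* The minimum is inserted inside the run under construction or after it.  The
   lengthening of an increasing run by an insertion at its start is charged to
   what precedes it, whence the two shapes. *)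
Let insertion_sum b : forall l, (0 < l)%N ->
  split l true b + tail l true b =
    D (W l true b) + x 1 * W l true b - W l.+1 true b
  /\ split l false b + x l * W 1 true b + tail l false b =
    D (W l false b) + x 1 * W l false b.
Proof.
elim: b => [|d b IH] l l0.
  by rewrite !tail0 !split0 // !Weq !Wneq // !W0; split; ring.
have [IHt IHf] := IH l.+1 isT; have [IH1t IH1f] := IH 1%N isT.
(* A run of length 1 cannot be cut into two nonempty pieces. *)
have split1 c : split 1 c b = 0 by rewrite /split big_geq.
rewrite split1 add0r in IH1t; rewrite split1 add0r in IH1f.
have Sl c := @splitS l c b l0.
move/(canRL (addKr _)): IH1f => IH1f; move/(canRL (addKr _)): IHt => IHt.
move/(canRL (addKr _)): IHf => IHf.
(* If the next letter prolongs the open run, the hypothesis at [l.+1] applies; if it closes the run,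
   the hypothesis at length 1 and the Leibniz rule do. *)
case: d; split.
- by rewrite !Weq tail_eq Wneq // Wneq // IHt Sl; ring.
- by rewrite split_neq // tail_neq // !Weq !Wneq // DM IH1t; ring.
- by rewrite split_neq // tail_neq // !Wneq // DM IH1f; ring.
- by rewrite !Weq tail_eq !Weq !Wneq // IHf Sl; ring.
Qed.

Lemma min_insertions_run_monomial b :
  \sum_(b' <- min_insertions b) run_monomial b' =
    D (run_monomial b) + 2 * x 1 * run_monomial b.
Proof.
rewrite /min_insertions big_cons big_rcons /=.
case: b => [|c b].
  by rewrite big_nil /run_monomial /= !big_seq1 big_nil leibniz1; ring.
have [IHt IHf] := @insertion_sum b 1 isT.
have split1 d : split 1 d b = 0 by rewrite /split big_geq.
rewrite split1 add0r in IHt; rewrite split1 add0r in IHf.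
rewrite /= big_cons big_map.
have E d b' : run_monomial (d :: b') = W 1 d b' by [].
rewrite 4!E (eq_bigr _ (fun b' _ => E c b')).
move: IHt IHf; rewrite /tail => /(canRL (addrK _)) IHt /(canRL (addKr _))/(canRL (addrK _)) IHf.
(* Besides [tail 1 c b] there remain the insertions in front and at the first letter. They give
   [x 1 * W 1 true b] plus either [W 2 true b] (first letter an ascent) or [x 1 * W 1 false b] (a
   descent); this cancels the correction term of [insertion_sum] and supplies the second [x 1]. *)
case: c => /=.
  by rewrite IHt Weq Wneq //; ring.
by rewrite IHf !Wneq //; ring.
Qed.


End RunMonomials.

(** * Runs of a permutation as maximal constant blocks of its ascent word *)

(** Refines [run_lengths_from] by keeping endpoints: the open run starts at [i], and [k] is the
    position of the next letter. *)
Fixpoint run_intervals_from (i k : nat) (c : bool) (b : bitseq) : seq (nat * nat) :=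
  if b is d :: b' then
    if d == c then run_intervals_from i k.+1 c b'
    else (i, k) :: run_intervals_from k k.+1 d b'
  else [:: (i, k)].

Lemma run_lengths_intervals b : forall i k c, (i <= k)%N ->
  run_lengths_from (k - i) c b = [seq (p.2 - p.1)%N | p <- run_intervals_from i k c b].
Proof.
elim: b => [|d b IH] i k c ik //=.
by case: eqP => _ /=; rewrite -IH ?subSnn ?subSn // leqW.
Qed.

Section BitRuns.
Variables (sg : nat -> bool) (n : nat).

(** Letter [k] compares entries [k] and [k.+1], so a run on entries [i..j] is a block of letters
    [i..j-1]. The last two clauses are maximality on either side. *)
Definition bit_run (i j : nat) : Prop :=
  [/\ (i < j <= n)%N, forall k, (i <= k < j)%N -> sg k = sg i,
      (0 < i)%N -> sg i.-1 != sg i & (j < n)%N -> sg j.-1 != sg j].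

(** A maximal block starting or ending strictly inside a constant stretch would have an equal letter
    next to it, against maximality. *)
Lemma bit_run_overlap i k c i' j' :
  (forall m, (i <= m < k)%N -> sg m = c) -> bit_run i' j' -> (i <= i' < k)%N ->
  (k <= n)%N -> i' = i /\ (k <= j')%N.
Proof.
move=> ck [/andP[ij jn] _ lft rgt] /andP[ii ik] kn; split.
  apply/eqP; rewrite eqn_leq ii andbT leqNgt; apply/negP => lt.
  have i'0 : (0 < i')%N by lia.
  by have := lft i'0; rewrite !ck ?eqxx //; lia.
rewrite leqNgt; apply/negP => lt; have jn' : (j' < n)%N by lia.
by have := rgt jn'; rewrite !ck ?eqxx //; lia.
Qed.

(** Induction on the number [r] of unread letters. The invariant says that letters [i..k-1] are
    equal and the block cannot be extended to the left; the bound [i <= p.1] singles out the runs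
    not yet emitted. *)
Lemma run_intervals_fromP r : forall i k c,
    (k + r)%N = n -> (i < k)%N -> (forall m, (i <= m < k)%N -> sg m = c) ->
    ((0 < i)%N -> sg i.-1 != sg i) ->
  uniq (run_intervals_from i k c (map sg (iota k r)))
  /\ forall p, p \in run_intervals_from i k c (map sg (iota k r)) <->
       bit_run p.1 p.2 /\ (i <= p.1)%N.
Proof.
elim: r => [|r IH] i k c kr ik ck lft /=.
  rewrite addn0 in kr; split=> // -[i' j']; rewrite inE /=; split.
    move=> /eqP[-> ->]; split=> //; split=> //; last by lia.
      by rewrite ik kr leqnn.
    by move=> m mk; rewrite !ck //; lia.
  move=> [rn ii]; have [/andP[ij jn] _ _ _] := rn.
  have [|-> kj] := bit_run_overlap ck rn _ (eq_leq kr); first by lia.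
  by apply/eqP; congr (_, _); lia.
have kr' : (k.+1 + r)%N = n by lia.
case: eqP => [skc|/eqP skc].
  apply: IH => //; first by lia.
  move=> m /andP[im]; rewrite ltnS leq_eqVlt => /orP[/eqP -> //|mk].
  by apply: ck; rewrite im.
have [|||uq mem] := IH k k.+1 (sg k) kr'.
- by [].
- by move=> m mk; congr sg; lia.
- by move=> k0; rewrite ck 1?eq_sym //; lia.
split=> /=.
  rewrite uq andbT; apply/negP => /mem[_ /=]; lia.
move=> [i' j']; rewrite inE; split.
  case/orP => [/eqP[-> ->]|/mem[rn /= ki]]; last by split=> //=; lia.
  split=> //=; split=> //; first by lia.
    by move=> m mk; rewrite !ck //; lia.
  by move=> _; rewrite ck 1?eq_sym //; lia.
move=> [/= rn ii]; have [ki|ki] := leqP k i'.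
  by apply/orP; right; apply/mem.
have kn : (k <= n)%N by lia.
have [|E kj] := bit_run_overlap ck rn _ kn; first by lia.
subst i'; apply/orP; left; apply/eqP; congr (_, _).
apply/eqP; rewrite eqn_leq kj andbT leqNgt; apply/negP => kj'.
have [_ cst _ _] := rn; move: skc; rewrite cst ?ck ?eqxx //; lia.
Qed.

Definition run_intervals : seq (nat * nat) :=
  if [seq sg k | k <- iota 0 n] is c :: b then run_intervals_from 0 1 c b else [::].

Lemma run_intervalsP :
  [/\ uniq run_intervals, forall p, p \in run_intervals <-> bit_run p.1 p.2 &
      run_lengths [seq sg k | k <- iota 0 n] = [seq (p.2 - p.1)%N | p <- run_intervals]].
Proof.
rewrite /run_intervals; case En: {1 2 3 4}n => [|r] /=.
  split=> // -[i j]; rewrite in_nil; split=> //; case=> /=; lia.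
have sg0 m : (0 <= m < 1)%N -> sg m = sg 0%N by move=> m0; congr sg; lia.
have [uq mem] := @run_intervals_fromP r 0 1 (sg 0%N) (esym En) isT sg0 (fun h => False_ind _ (notF h)).
split=> //; last by rewrite -run_lengths_intervals.
by move=> p; split=> [/mem[]|rn] //; apply/mem.
Qed.

End BitRuns.

Lemma incr_lt_in (f : nat -> nat) i j :
  (forall k, (i <= k < j)%N -> (f k < f k.+1)%N) ->
  forall a b, [&& i <= a, a < b & b <= j]%N -> (f a < f b)%N.
Proof.
move=> incr a; elim=> [|b IH] /and3P[ia ab bj]; first by [].
have lt : (f b < f b.+1)%N by apply: incr; lia.
move: ab; rewrite ltnS leq_eqVlt => /orP[/eqP -> //|ab].
by apply: ltn_trans lt; apply: IH; rewrite ia ab ltnW.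
Qed.

Lemma decr_lt_in (f : nat -> nat) i j :
  (forall k, (i <= k < j)%N -> (f k.+1 < f k)%N) ->
  forall a b, [&& i <= a, a < b & b <= j]%N -> (f b < f a)%N.
Proof.
move=> decr a; elim=> [|b IH] /and3P[ia ab bj]; first by [].
have lt : (f b.+1 < f b)%N by apply: decr; lia.
move: ab; rewrite ltnS leq_eqVlt => /orP[/eqP -> //|ab].
by apply: ltn_trans lt _; apply: IH; rewrite ia ab ltnW.
Qed.

Section Ascents.
Variables (n : nat) (s : 'S_n.+1).

(** For [k < n], the only letters read by [ascents], both uses of [inord] are faithful. *)
Definition ascent (k : nat) : bool := (s (inord k) < s (inord k.+1))%N.

Definition ascents : bitseq := [seq ascent k | k <- iota 0 n].

Let f (k : nat) : nat := s (inord k).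

Lemma monotone_betweenP (i j : 'I_n.+1) : (i < j)%N ->
  reflect (forall k, (i <= k < j)%N -> ascent k = ascent i) (monotone_between s i j).
Proof.
move=> ij; have jn := ltn_ord j.
have inordK' k : (k <= j)%N -> nat_of_ord (@inord n k) = k by move=> kj; rewrite inordK //; lia.
apply: (iffP orP) => [|cst].
- case=> /forallP mono.
  + have up k : (i <= k < j)%N -> ascent k.
      move=> kij; move: (mono (inord k)) => /forallP /(_ (inord k.+1)).
      by move/implyP; apply; rewrite !inordK'; lia.
    by move=> k kij; rewrite !up //; lia.
  + have down k : (i <= k < j)%N -> ascent k = false.
      move=> kij; apply/negbTE; rewrite -leqNgt ltnW //.
      move: (mono (inord k)) => /forallP /(_ (inord k.+1)).
      by move/implyP; apply; rewrite !inordK'; lia.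
    by move=> k kij; rewrite !down //; lia.
case ai: (ascent i); [left|right]; apply/forallP => a; apply/forallP => b; apply/implyP.
  move=> ab; have := @incr_lt_in f i j _ a b ab; rewrite /f !inord_val; apply.
  by move=> k kij; have := cst _ kij; rewrite ai.
move=> ab; have := @decr_lt_in f i j _ a b ab; rewrite /f !inord_val; apply.
(* A position that is not an ascent is a strict descent, because [s] is injective. *)
move=> k kij; have := cst _ kij; rewrite ai /ascent => /negbT; rewrite -leqNgt leq_eqVlt.
case/orP => // /eqP /val_inj /perm_inj /(congr1 (@nat_of_ord _)).
by rewrite !inordK'; lia.
Qed.

(** Maximality among all intervals reduces to the one-step extensions to [i.-1] and [j.+1]: any
    larger monotone interval contains one of the two neighbouring letters. *)
Lemma is_runP (i j : 'I_n.+1) : reflect (bit_run ascent n i j) (is_run s (i, j)).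
Proof.
have jn := ltn_ord j.
apply: (iffP and3P) => /= [[ij mono /forallP mx]|[/andP[ij _] cst lft rgt]].
  have cst := monotone_betweenP ij mono.
  split=> // [|i0|jn'].
  - by rewrite ij -ltnS.
  - apply/eqP => E; pose i' : 'I_n.+1 := inord i.-1.
    have vi : nat_of_ord i' = i.-1 by rewrite inordK //; lia.
    move: (mx i') => /forallP /(_ j) /implyP; rewrite leqnn vi leq_pred /=.
    have -> : monotone_between s i' j.
      apply/monotone_betweenP; rewrite vi; first by lia.
      move=> k /andP[ki kj]; have [->//|ki'] := eqVneq k i.-1.
      by rewrite E; apply: cst; lia.
    by move=> /(_ isT) /andP[/eqP /(congr1 (@nat_of_ord _))]; rewrite vi; lia.
  - apply/eqP => E; pose j' : 'I_n.+1 := inord j.+1.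
    have vj : nat_of_ord j' = j.+1 by rewrite inordK //; lia.
    move: (mx i) => /forallP /(_ j') /implyP; rewrite leqnn vj leqnSn /=.
    have -> : monotone_between s i j'.
      apply/monotone_betweenP; rewrite vj; first by lia.
      move=> k /andP[ki kj]; have [->|kj'] := eqVneq k j; last by apply: cst; lia.
      by rewrite -E; apply: cst; lia.
    by move=> /(_ isT) /andP[_ /eqP /(congr1 (@nat_of_ord _))]; rewrite vj; lia.
split=> //; first exact/monotone_betweenP.
apply/forallP => i'; apply/forallP => j'; apply/implyP => /and3P[ii jj].
have jn' := ltn_ord j'.
move/monotone_betweenP => /(_ ltac:(lia)) cst'.
apply/andP; split; rewrite -val_eqE /= eqn_leq.
  rewrite ii /= leqNgt; apply/negP => lt.
  have i0 : (0 < i)%N by lia.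
  by have := lft i0; rewrite !cst' ?eqxx //; lia.
rewrite jj andbT leqNgt; apply/negP => lt.
have jn2 : (j < n)%N by lia.
by have := rgt jn2; rewrite !cst' ?eqxx //; lia.
Qed.

(** Sorting forgets the order, so it suffices that both lists come from duplicate-free enumerations
    of the same runs. *)
Lemma run_structureE : run_structure s = sort geq (run_lengths ascents).
Proof.
have [uq mem ->] := run_intervalsP ascent n.
apply/perm_sortP.
- by move=> x y; exact: leq_total.
- by move=> x y z yx xz; exact: leq_trans xz yx.
- by move=> x y /andP[yx xy]; apply/eqP; rewrite eqn_leq; apply/andP.
pose v (ij : 'I_n.+1 * 'I_n.+1) : nat * nat := (nat_of_ord ij.1, nat_of_ord ij.2).
have -> : [seq (ij.2 - ij.1)%N | ij : 'I_n.+1 * 'I_n.+1 in is_run s] =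
    [seq (p.2 - p.1)%N | p <- map v (enum (is_run s))].
  by rewrite -map_comp; apply: eq_map => -[].
apply: perm_map; apply: uniq_perm => //.
  rewrite map_inj_uniq ?enum_uniq // => -[i j] [i' j'] [] /=.
  by move=> /val_inj -> /val_inj ->.
move=> [i j]; apply/mapP/idP.
  by move=> [[i' j']]; rewrite mem_enum => /is_runP rn [-> ->]; apply/mem.
move=> /mem /= rn; have [/andP[ij jn] _ _ _] := rn.
have jn' : (j < n.+1)%N by lia. have in' : (i < n.+1)%N by lia.
exists (Ordinal in', Ordinal jn') => //; rewrite mem_enum; exact/is_runP.
Qed.

End Ascents.

Lemma sumn_run_lengths_from b : forall l c,
  sumn (run_lengths_from l c b) = (l + size b)%N.
Proof.
elim: b => [|d b IH] l c /=; first by rewrite !addn0.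
by case: eqP => _ /=; rewrite IH ?addSnnS ?add1n.
Qed.

Lemma run_lengths_from_neq0 b : forall l c, (0 < l)%N -> 0%N \notin run_lengths_from l c b.
Proof.
elim: b => [|d b IH] l c l0 /=; first by rewrite inE; case: l l0.
by case: eqP => _; rewrite ?IH // inE negb_or IH //; case: l l0.
Qed.

Lemma run_structure_partition n (s : 'S_n.+1) : is_partition n (run_structure s).
Proof.
rewrite run_structureE; apply/and3P; split.
- by apply: sort_sorted => x y; exact: leq_total.
- rewrite mem_sort; case: (ascents s) => [|c b] //=; exact: run_lengths_from_neq0.
rewrite (perm_sumn (permEl (perm_sort _ _))).
have {2}<- : size (ascents s) = n by rewrite size_map size_iota.
by case: (ascents s) => [|c b] //=; rewrite sumn_run_lengths_from.
Qed.

Lemma prod_count_mem (S : comPzSemiRingType) (x : nat -> S) (r p : seq nat) :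
  uniq r -> {subset p <= r} ->
  \prod_(i <- r) x i ^+ count_mem i p = \prod_(a <- p) x a.
Proof.
move=> ur; elim: p => [|a p IH] pr.
  by rewrite big_nil big1.
rewrite big_cons -IH; last by move=> i ip; apply: pr; rewrite inE ip orbT.
have ar : a \in r by apply: pr; rewrite inE eqxx.
rewrite (bigD1_seq a) //= [in RHS](bigD1_seq a) //= eqxx add1n exprS mulrA.
by congr (_ * _); apply: eq_bigr => i ia; rewrite eq_sym (negPf ia) add0n.
Qed.

Lemma prod_intpart (S : comPzSemiRingType) (x : nat -> S) n (p : intpart n) :
  \prod_(1 <= i < n.+1) x i ^+ count_mem i p = \prod_(a <- p) x a.
Proof.
apply: prod_count_mem; first exact: iota_uniq.
move=> a ap; rewrite mem_index_iota ltnS (partition_bounds (partsP p)).2 // andbT lt0n.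
by apply: contraTneq ap => ->; have /and3P[] := partsP p.
Qed.

(** Permutations are grouped by run structure; sorting the run lengths does not affect their
    monomial. *)
Lemma sum_run_structure (S : comPzSemiRingType) (x : nat -> S) n :
  \sum_(p : intpart n) (Z_S p)%:R * \prod_(1 <= i < n.+1) x i ^+ count_mem i p =
  \sum_(s : 'S_n.+1) \prod_(a <- run_lengths (ascents s)) x a.
Proof.
pose rs (s : 'S_n.+1) := IntPart (run_structure_partition s).
rewrite [RHS](partition_big rs predT) //=; apply: eq_bigr => p _.
rewrite prod_intpart /Z_S cardsE -sum1_card natr_sum mulr_suml.
apply: eq_big => [s|s /eqP <-]; first by rewrite -val_eqE.
rewrite mul1r run_structureE; apply: perm_big; exact: permEl (perm_sort _ _).
Qed.

(** * Inserting a new minimum into a permutation *)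

Lemma size_bit_splits b : size (bit_splits b) = size b.
Proof. by elim: b => //= c b IH; rewrite size_map IH. Qed.

Lemma nth_bit_splits b : forall j k, (j < size b)%N -> (k <= size b)%N ->
  nth false (nth [::] (bit_splits b) j) k =
    if (k < j)%N then nth false b k
    else if k == j then false else if k == j.+1 then true else nth false b k.-1.
Proof.
elim: b => [|c b IH] //= [|j] k jb kb /=; first by case: k kb => [|[|k]].
rewrite (nth_map [::]) ?size_bit_splits //; case: k kb => [|k] kb //=.
by rewrite IH // ltnS !eqSS; case: k kb => [|k] kb //=; case: j jb.
Qed.

Lemma size_min_insertions b b' : b' \in min_insertions b -> size b' = (size b).+1.
Proof.
rewrite inE mem_rcons inE => /orP[/eqP -> //|/orP[/eqP ->|]]; first by rewrite size_rcons.
elim: b b' => //= c b IH b'; rewrite inE => /orP[/eqP -> //|/mapP[b1 /IH E ->]] /=.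
by rewrite E.
Qed.

(** The extreme insertions fit the formula for the inner ones: for [i = 0] the descent, and for
    [i = (size b).+1] the ascent, falls outside the word. *)
Lemma nth_min_insertions b i k : (i <= (size b).+1)%N -> (k <= size b)%N ->
  nth false (nth [::] (min_insertions b) i) k =
    if (k.+1 < i)%N then nth false b k
    else if k.+1 == i then false else if k == i then true else nth false b k.-1.
Proof.
case: i => [|i] ib kb; first by case: k kb.
rewrite /min_insertions /= nth_rcons size_bit_splits ltnS eqSS.
move: ib; rewrite ltnS leq_eqVlt => /orP[/eqP ->|ib]; last first.
  by rewrite ib nth_bit_splits.
rewrite ltnn eqxx nth_rcons; case: ltngtP kb => //.
Qed.

Section LiftPerm.
Variables (n : nat) (s : 'S_n.+1) (i : 'I_n.+2).

(** Sending [i] to [ord0] makes the lifted permutation the insertion of a new minimum at position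
    [i]; all old values go up by one. *)
Lemma lift_perm0E k : (k < n.+2)%N -> nat_of_ord (lift_perm i ord0 s (inord k)) =
  if k == i then 0%N else (s (inord (if (k < i)%N then k else k.-1))).+1.
Proof.
move=> kn; case: eqP => [->|/eqP ki]; first by rewrite inord_val lift_perm_id.
have in2 := ltn_ord i.
pose k' : 'I_n.+1 := inord (if (k < i)%N then k else k.-1).
have -> : inord k = lift i k' :> 'I_n.+2.
  apply: val_inj; rewrite /= inordK // /k'; case: ltnP => h.
    by rewrite inordK; [rewrite /bump leqNgt h|lia].
  by rewrite inordK; [rewrite /bump; have -> : (i <= k.-1)%N by lia|]; lia.
by rewrite lift_perm_lift.
Qed.

Lemma ascents_lift_perm :
  ascents (lift_perm i ord0 s) = nth [::] (min_insertions (ascents s)) i.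
Proof.
have szA : size (ascents s) = n by rewrite size_map size_iota.
have in2 := ltn_ord i.
have szi : size (nth [::] (min_insertions (ascents s)) i) = n.+1.
  rewrite (@size_min_insertions (ascents s)) ?szA // mem_nth //=.
  by rewrite size_rcons size_bit_splits szA.
apply: (@eq_from_nth _ false); first by rewrite szi size_map size_iota.
rewrite size_map size_iota => k kn.
rewrite nth_min_insertions ?szA //.
have nthA m (mn : (m < n)%N) : nth false (ascents s) m = ascent s m.
  by rewrite (nth_map 0%N) ?size_iota // nth_iota.
rewrite (nth_map 0%N) ?size_iota // nth_iota // /ascent !lift_perm0E //; last by lia.
(* The compared entries both precede the minimum; or the first is the minimum or both follow it; or
   the second is the minimum. *)
have [ki|ki|ki] := ltngtP k.+1 i.
- have -> : (k == i) = false by lia.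
  rewrite nthA //; lia.
- have [->|ki'] := eqVneq k i; first by [].
  rewrite nthA /ascent ?prednK //; lia.
- by have -> : (k == i) = false by lia.
Qed.

End LiftPerm.

(** Cardinalities agree, so injectivity suffices; the position is recovered as the preimage of the
    minimum. *)
Lemma lift_perm0_bij n :
  bijective (fun p : 'I_n.+2 * 'S_n.+1 => lift_perm p.1 ord0 p.2).
Proof.
apply: inj_card_bij; last first.
  by rewrite card_prod !card_Sn card_ord -factS.
move=> [i s] [j t] /= E.
have ij : i = j.
  by apply: (@perm_inj _ (lift_perm j ord0 t)); rewrite -{1}E !lift_perm_id.
rewrite -{j}ij in E *; congr (_, _); apply/permP => k.
by apply: (@lift_inj _ ord0); rewrite -!(lift_perm_lift i) E.
Qed.

Lemma sum_ascents_min_insertions (S : nmodType) n (F : bitseq -> S) :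
  \sum_(t : 'S_n.+2) F (ascents t) =
  \sum_(s : 'S_n.+1) \sum_(b <- min_insertions (ascents s)) F b.
Proof.
rewrite (reindex _ (onW_bij _ (lift_perm0_bij n))) /=.
rewrite -(pair_bigA _ (fun i s => F (ascents (lift_perm i ord0 s)))) exchange_big /=.
apply: eq_bigr => s _; rewrite (big_nth [::]) big_mkord.
have -> : size (min_insertions (ascents s)) = n.+2.
  by rewrite /= size_rcons size_bit_splits size_map size_iota.
by apply: eq_bigr => i _; rewrite ascents_lift_perm.
Qed.

Lemma sum_run_monomialS (S : comNzRingType) (x : nat -> S) (D : S -> S) n :
  additive D -> (forall P Q, D (P * Q) = D P * Q + P * D Q) ->
  (forall l, (0 < l)%N -> D (x l) = x l.+1 + \sum_(1 <= j < l) x 1%N * x j * x (l - j)%N) ->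
  let ell m := \sum_(s : 'S_m.+1) run_monomial x (ascents s) in
  ell n.+1 = D (ell n) + 2 * x 1%N * ell n.
Proof.
move=> DD DM Dx ell; rewrite {}/ell sum_ascents_min_insertions.
pose D' : {additive S -> S} := HB.pack D (GRing.isZmodMorphism.Build S S D DD).
rewrite [D _](raddf_sum D') mulr_sumr -big_split; apply: eq_bigr => s _ /=.
exact: min_insertions_run_monomial.
Qed.

(** * From the derivation to the binomial recurrence *)

Section DerivationRecurrence.
Variables (S : comNzRingType) (x1 : S) (D : S -> S).
Hypotheses (DD : additive D) (DM : forall P Q, D (P * Q) = D P * Q + P * D Q).
Variable ell : nat -> S.
Hypotheses (ell0 : ell 0%N = 1) (ellS : forall n, ell n.+1 = D (ell n) + 2 * x1 * ell n).

Let Dsum (I : Type) (r : seq I) (F : I -> S) : D (\sum_(i <- r) F i) = \sum_(i <- r) D (F i).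
Proof.
pose D' : {additive S -> S} := HB.pack D (GRing.isZmodMorphism.Build S S D DD).
exact: (raddf_sum D').
Qed.

Let DMn P n : D (P *+ n) = D P *+ n.
Proof.
pose D' : {additive S -> S} := HB.pack D (GRing.isZmodMorphism.Build S S D DD).
exact: (raddfMn D').
Qed.

(* Coefficientwise form of the differential equation L' = 2 A L. *)
Lemma derivation_recurrence n :
  ell n.+1 = \sum_(k < n.+1) (iter k D x1 * ell (n - k)) *+ (2 * 'C(n, k)).
Proof.
elim: n => [|n IH].
  by rewrite big_ord1 ellS ell0 (leibniz1 DM) add0r !mulr1 mulr_natl.
rewrite ellS {}IH Dsum mulr_sumr -big_split /=.
(* By Leibniz, [D] acts on either factor; where it acts on [ell], the term [2 * x1] completes it to
   the next [ell]. *)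
transitivity (\sum_(k < n.+1) (iter k.+1 D x1 * ell (n - k)) *+ (2 * 'C(n, k))
    + \sum_(k < n.+1) (iter k D x1 * ell (n.+1 - k)) *+ (2 * 'C(n, k))).
  rewrite -big_split; apply: eq_bigr => k _ /=.
  rewrite subSn; last by rewrite -ltnS.
  rewrite ellS DMn DM mulrnAr -!mulrnDl; congr (_ *+ _).
  by ring.
rewrite [RHS]big_ord_recl bin0 muln1 subn0.
(* Pascal's rule splits the target to match the two sums. *)
rewrite [X in _ = _ + X](eq_bigr (fun k : 'I_n.+1 =>
    (iter k.+1 D x1 * ell (n - k)) *+ (2 * 'C(n, k.+1))
    + (iter k.+1 D x1 * ell (n - k)) *+ (2 * 'C(n, k)))); last first.
  by move=> k _; rewrite lift0 subSS binS mulnDr mulrnDr.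
rewrite big_split /= addrA addrC; congr (_ + _).
rewrite big_ord_recl bin0 muln1 subn0; congr (_ + _).
(* The surplus last term carries ['C(n, n.+1)], which is zero. *)
by rewrite [RHS]big_ord_recr /= bin_small // muln0 mulr0n addr0.
Qed.

End DerivationRecurrence.

(** * The exponential series through its differential equation *)

Section ExponentialRecurrence.
Variable R : comAlgType rat.
Implicit Types f g u v : fps R.

(** The equation g' = f' g, read on coefficients. *)
Definition exp_recurrence f g : Prop :=
  forall n, g n.+1 *+ n.+1 = \sum_(i < n.+1) (f i.+1 *+ i.+1) * g (n - i)%N.

Lemma scale_natV (n : nat) (a : R) : (n.+1%:R^-1 : rat) *: (a *+ n.+1) = a.
Proof. by rewrite -scaler_nat scalerA mulVf ?scale1r // pnatr_eq0. Qed.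

(** Over the rationals [n.+1] can be divided out, so each coefficient is determined by the earlier
    ones. *)
Lemma exp_recurrence_unique f u v : u 0%N = v 0%N ->
  exp_recurrence f u -> exp_recurrence f v -> u =1 v.
Proof.
move=> uv0 ru rv n; have [m] := ubnP n; elim: m n => // m IH [//|n] nm.
rewrite -[LHS](scale_natV n) -[RHS](scale_natV n) ru rv; congr (_ *: _).
by apply: eq_bigr => i _; rewrite IH //; lia.
Qed.

Lemma fps_powS f k m :
  fps_pow f k.+1 m = \sum_(i < m.+1) f i * fps_pow f k (m - i)%N.
Proof. by []. Qed.

(** Truncation to a polynomial gives access to the derivative of a power of polynomials. *)
Lemma fps_pow_poly f N k m : (m <= N)%N ->
  fps_pow f k m = ((\poly_(i < N.+1) f i) ^+ k)`_m.
Proof.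
elim: k m => [|k IH] m mN; first by rewrite expr0 coef1.
rewrite exprS coefM fps_powS; apply: eq_bigr => -[i im] _ /=.
rewrite coef_poly IH; last by lia.
by have -> : (i < N.+1)%N by lia.
Qed.

Lemma fps_pow_lt f k m : f 0%N = 0 -> (m < k)%N -> fps_pow f k m = 0.
Proof.
move=> f0; elim: k m => // k IH m mk; rewrite fps_powS big1 // => -[[|i] im] _ /=.
  by rewrite f0 mul0r.
by rewrite IH ?mulr0 //; lia.
Qed.

Lemma fps_pow_deriv f k n :
  fps_pow f k.+1 n.+1 *+ n.+1 =
  (\sum_(i < n.+1) (f i.+1 *+ i.+1) * fps_pow f k (n - i)%N) *+ k.+1.
Proof.
rewrite (@fps_pow_poly f n.+1) // -coef_deriv deriv_exp coefMn coefM.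

congr (_ *+ _); apply: eq_bigr => -[i im] _ /=.
rewrite coef_deriv coef_poly ltnS im (@fps_pow_poly f n.+1) ?(leq_trans (leq_subr _ _)) //.
Qed.

Lemma fps_exp0 f : fps_exp f 0%N = 1.
Proof. by rewrite /fps_exp big_ord1 /= invr1 scale1r. Qed.

Lemma fps_exp_recurrence f : f 0%N = 0 -> exp_recurrence f (fps_exp f).
Proof.
move=> f0 n; rewrite /fps_exp big_ord_recl /= [fps_one _ _]/= scaler0 add0r.
rewrite -sumrMnl.
transitivity (\sum_(k < n.+1) (k`!%:R^-1 : rat) *:
    \sum_(i < n.+1) (f i.+1 *+ i.+1) * fps_pow f k (n - i)%N).
  apply: eq_bigr => k _; rewrite -[bump 0 k]/(k.+1) scalerMnr fps_pow_deriv factS.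
  rewrite -scaler_nat scalerA natrM invfM mulrAC mulVf ?mul1r // pnatr_eq0.
  by [].
rewrite (eq_bigr (fun k : 'I_n.+1 => \sum_(i < n.+1)
    (k`!%:R^-1 : rat) *: (f i.+1 *+ i.+1 * fps_pow f k (n - i)%N))); last first.
  by move=> k _; rewrite scaler_sumr.
rewrite exchange_big /=; apply: eq_bigr => -[i im] _ /=; rewrite mulr_sumr.
(* The exponential at index [n - i] stops at [k = n - i]; the added terms vanish because the [k]-th
   power of [f] has order at least [k]. *)
rewrite [RHS](big_ord_widen n.+1 (fun k => f i.+1 *+ i.+1 * ((k`!%:R^-1 : rat) *: fps_pow f k (n - i)%N))); last by lia.
rewrite [RHS]big_mkcond; apply: eq_bigr => k _; rewrite -scalerAr.
by case: ltnP => // ki; rewrite fps_pow_lt // mulr0 scaler0.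
Qed.

End ExponentialRecurrence.

(** * Adding a part to a partition, and sums over partitions *)

Lemma is_partition_add n a (q : intpart (n - a)) : (0 < a <= n)%N ->
  is_partition n (sort geq (a :: q)).
Proof.
move=> /andP[a0 an]; have /and3P[_ q0 /eqP qn] := partsP q; apply/and3P; split.
- by apply: sort_sorted => x y; exact: leq_total.
- by rewrite mem_sort inE negb_or q0 andbT; case: a a0 {an q q0 qn}.
by rewrite (perm_sumn (permEl (perm_sort _ _))) /= qn subnKC.
Qed.

Lemma intpart_perm_inj n (p q : intpart n) : perm_eq p q -> p = q.
Proof.
have /and3P[sp _ _] := partsP p; have /and3P[sq _ _] := partsP q.
move=> pq; apply/val_inj/(sorted_eq _ _ sp sq pq).
  by move=> x y z yx xz; exact: leq_trans xz yx.
by move=> x y /andP[yx xy]; apply/eqP; rewrite eqn_leq; apply/andP.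
Qed.

Section AddPart.
Variables (n a : nat) (an : (0 < a <= n)%N).

Definition add_part (q : intpart (n - a)) : intpart n :=
  IntPart (is_partition_add q an).

Lemma perm_add_part q : perm_eq (add_part q) (a :: q).
Proof. exact: permEl (perm_sort _ _). Qed.

Lemma add_part_inj : injective add_part.
Proof.
move=> q q' E; apply: intpart_perm_inj; rewrite -(perm_cons a).
by rewrite -(permPl (perm_add_part q)) E; exact: perm_add_part.
Qed.

Lemma add_part_surj (p : intpart n) : a \in parts p -> exists q, p = add_part q.
Proof.
move=> ap; have /and3P[sp p0 /eqP pn] := partsP p.
have part : is_partition (n - a) (rem a p).
  apply/and3P; split.
  - apply: subseq_sorted sp; last exact: rem_subseq.
    by move=> x y z yx xz; exact: leq_trans xz yx.
  - by apply: contra p0; exact: mem_rem.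
  by have E := perm_sumn (perm_to_rem ap); rewrite pn /= in E; apply/eqP; lia.
exists (IntPart part); apply: intpart_perm_inj.
rewrite (permPr (perm_add_part _)); exact: perm_to_rem.
Qed.

(** Removing one copy of [a] inverts [add_part] on the partitions that contain [a]. *)
Lemma sum_intpart_mem (S : nmodType) (F : intpart n -> S) :
  \sum_(p : intpart n | a \in parts p) F p = \sum_(q : intpart (n - a)) F (add_part q).
Proof.
rewrite -[RHS](big_imset F (in2W add_part_inj)) /=.
apply: eq_bigl => p; apply/idP/imsetP => [/add_part_surj[q ->]|[q _ ->]].
  by exists q.
by rewrite (perm_mem (perm_add_part q)) inE eqxx.
Qed.

End AddPart.

(** Values above [n] have multiplicity 0 and contribute [0! = 1]; this puts partitions of [n - a]
    and of [n] over one range. *)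
Lemma sym_ordE n (p : intpart n) N : (n <= N)%N ->
  sym_ord p = (\prod_(1 <= i < N.+1) (count_mem i p)`!)%N.
Proof.
move=> nN; rewrite /sym_ord (big_cat_nat (n := n.+1) (p := N.+1)) //=.
rewrite [X in (_ * X)%N]big_nat_cond [X in (_ * X)%N]big1 ?muln1 // => i /andP[/andP[ni _] _].
rewrite (count_memPn _) //; apply: contraTN ni => /(partition_bounds (partsP p)).2.
by rewrite -leqNgt.
Qed.

Lemma sym_ord_add n a (an : (0 < a <= n)%N) (q : intpart (n - a)) :
  sym_ord (add_part an q) = ((count_mem a q).+1 * sym_ord q)%N.
Proof.
rewrite (@sym_ordE _ q n) ?leq_subr // /sym_ord.
have ar : a \in index_iota 1 n.+1 by rewrite mem_index_iota ltnS.
rewrite (bigD1_seq a) ?iota_uniq //= [in RHS](bigD1_seq a) ?iota_uniq //= mulnA.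
have cnt i : count_mem i (add_part an q) = ((a == i) + count_mem i q)%N.
  by rewrite (seq.permP (perm_add_part an q)).
rewrite cnt eqxx add1n factS; congr (_ * _)%N; apply: eq_bigr => i ia.
by rewrite cnt eq_sym (negPf ia).
Qed.

Lemma sum_count_mem (r p : seq nat) : uniq r -> {subset p <= r} ->
  (\sum_(i <- r) count_mem i p * i)%N = sumn p.
Proof.
move=> ur; elim: p => [|a p IH] pr.
  by rewrite big1.
rewrite /= -IH; last by move=> i ip; apply: pr; rewrite inE ip orbT.
have ar : a \in r by apply: pr; rewrite inE eqxx.
rewrite (bigD1_seq a) //= [in RHS](bigD1_seq a) //= eqxx mulnDl mul1n addnA.
by congr (_ + _)%N; apply: eq_bigr => i ia; rewrite eq_sym (negPf ia) add0n.
Qed.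

Lemma sum_count_intpart n (p : intpart n) :
  (\sum_(i < n) count_mem i.+1 p * i.+1)%N = n.
Proof.
have /and3P[_ p0 /eqP pn] := partsP p.
rewrite -(big_mkord xpredT (fun i => count_mem i.+1 p * i.+1)%N) -[LHS](big_add1 _ _ 0 n.+1 xpredT (fun i => count_mem i p * i)%N).
rewrite sum_count_mem ?iota_uniq // => a ap.
rewrite mem_index_iota ltnS (partition_bounds (partsP p)).2 // andbT lt0n.
by apply: contraNneq p0 => <-.
Qed.

Section PartitionSum.
Variables (R : comAlgType rat) (c : fps R).

(** The term indexed by [p] in the expansion of the exponential of the sum of the [c i], [i >= 1]:
    each size of multiplicity [m] contributes [c i ^+ m / m!]. *)
Definition intpart_weight n (p : intpart n) : R :=
  ((sym_ord p)%:R^-1 : rat) *: \prod_(a <- p) c a.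

Definition partition_sum : fps R := fun n => \sum_(p : intpart n) intpart_weight p.

Lemma intpart_weight_add n a (an : (0 < a <= n)%N) (q : intpart (n - a)) :
  intpart_weight (add_part an q) *+ count_mem a (add_part an q) =
  c a * intpart_weight q.
Proof.
rewrite /intpart_weight sym_ord_add (seq.permP (perm_add_part an q)) /= eqxx add1n.
rewrite (perm_big _ (perm_add_part an q)) big_cons -scalerAr -scaler_nat scalerA.
by congr (_ *: _); rewrite natrM invfM mulrA divff ?mul1r // pnatr_eq0.
Qed.

(** The factor [n.+1] is the sum of the parts of [p], grouped by size [i.+1]. Removing one such part
    turns multiplicity times weight into [c i.+1] times the weight of a partition of [n - i]. *)
Lemma partition_sum_recurrence : exp_recurrence c partition_sum.
Proof.
move=> n; rewrite /partition_sum -sumrMnl.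
transitivity (\sum_(p : intpart n.+1) \sum_(i < n.+1)
    intpart_weight p *+ (count_mem i.+1 p * i.+1)).
  by apply: eq_bigr => p _; rewrite sumrMnr sum_count_intpart.
rewrite exchange_big /=; apply: eq_bigr => i _.
have i1 : (0 < i.+1 <= n.+1)%N by exact: ltn_ord.
rewrite mulr_sumr (bigID (fun p : intpart n.+1 => i.+1 \in parts p)) /= [X in _ + X]big1.
  rewrite addr0 (sum_intpart_mem i1); apply: eq_bigr => q _.
  by rewrite mulrnA intpart_weight_add mulrnAl.
by move=> p /count_memPn ->; rewrite mulr0n.
Qed.

Lemma partition_sum0 : partition_sum 0%N = 1.
Proof.
have p0 : is_partition 0 [::] by [].
rewrite /partition_sum (big_pred1 (IntPart p0)) => [|p].
  by rewrite /intpart_weight /sym_ord big_geq // big_nil invr1 scale1r.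
apply/esym/eqP; apply: intpart_perm_inj; have [+ _] := partition_bounds (partsP p).
by rewrite leqn0 size_eq0 => /eqP ->.
Qed.

End PartitionSum.

(** * The two formulas from the binomial recurrence *)

Section ExponentialFormula.
Variables (R : comAlgType rat) (a l : nat -> R).
Hypothesis l0 : l 0%N = 1.
Hypothesis lS : forall n,
  l n.+1 = \sum_(k < n.+1) (a k.+1 * l (n - k)%N) *+ (2 * 'C(n, k)).

Let f : fps R := fps_scale 2 (fps_int (fun n => (n`!%:R^-1 : rat) *: a n.+1)).
Let g : fps R := fun n => (n`!%:R^-1 : rat) *: l n.

Let fE n : (0 < n)%N -> f n = (2 / n`!%:R : rat) *: a n.
Proof.
by case: n => // n _; rewrite /f /fps_scale /fps_int !scalerA factS natrM invfM mulrA.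
Qed.

Let g_recurrence : exp_recurrence f g.
Proof.
move=> n; rewrite /g lS scaler_sumr -sumrMnl; apply: eq_bigr => -[k kn] _ /=.
have kn' : (k <= n)%N by [].
rewrite fE // -!scaler_nat -!scalerAl -!scalerAr !scalerA; congr (_ *: _).
have fact0 m : m`!%:R != 0 :> rat by rewrite pnatr_eq0 -lt0n fact_gt0.
have S0 m : m.+1%:R != 0 :> rat by rewrite pnatr_eq0.
(* Substituting this for the factorial of [n] turns the binomial recurrence into the convolution of
   [f] and [g]. *)
have : 'C(n, k)%:R * (k`!%:R * (n - k)`!%:R) = n`!%:R :> rat.
  by rewrite -!natrM bin_fact.
rewrite !factS !natrM => <-.
have C0 : 'C(n, k)%:R != 0 :> rat by rewrite pnatr_eq0 -lt0n bin_gt0.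
by field; rewrite !fact0 C0 !(addrC 1) !natr1 !S0.
Qed.

Lemma exponential_formula : g =1 fps_exp f.
Proof.
apply: exp_recurrence_unique g_recurrence (fps_exp_recurrence _).
  by rewrite fps_exp0 /g l0 invr1 scale1r.
by rewrite /f /fps_scale /fps_int scaler0.
Qed.

(** Uniqueness identifies [g] with the partition sum of [f]; each part [b] then contributes
    [2 / b!], and the factor [n!] completes the multinomial coefficient. *)
Lemma partition_formula n :
  l n = \sum_(p : intpart n)
    (2 ^+ size p / (sym_ord p)%:R * multinom p) *: \prod_(b <- p) a b.
Proof.
have E : partition_sum f =1 g.
  apply: exp_recurrence_unique (@partition_sum_recurrence _ f) g_recurrence.
  by rewrite partition_sum0 /g l0 invr1 scale1r.
have fact0 : n`!%:R != 0 :> rat by rewrite pnatr_eq0 -lt0n fact_gt0.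
have -> : l n = n`!%:R *: g n by rewrite /g scalerA divff // scale1r.
rewrite -E /partition_sum scaler_sumr; apply: eq_bigr => p _; rewrite /intpart_weight.
have -> : \prod_(b <- p) f b = (2 ^+ size p / \prod_(b <- p) b`!%:R : rat) *: \prod_(b <- p) a b.
  have /and3P[_ + _] := partsP p; elim: (parts p) => [|b q IH].
    by rewrite !big_nil divr1 scale1r.
  rewrite inE negb_or eq_sym -lt0n => /andP[b0 /IH {}IH].
  rewrite !big_cons IH fE // -scalerAl -scalerAr scalerA /= exprS invfM.
  by congr (_ *: _); ring.
rewrite !scalerA /multinom; congr (_ *: _).
by ring.
Qed.

End ExponentialFormula.

(** * Passage to rational coefficients and conclusion *)

Lemma mcoeff_toQ (P : polyX int) m : (toQ P)@_m = (P@_m)%:~R.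
Proof. by rewrite mcoeffE; case: msuppP. Qed.

Lemma toQ_is_additive : additive toQ.
Proof. by move=> P Q; apply/malgP => m; rewrite mcoeffB !mcoeff_toQ mcoeffB rmorphB. Qed.

Lemma msupp_toQ (P : polyX int) : (msupp (toQ P) `<=` msupp P)%fset.
Proof.
apply/fsubsetP => m; rewrite -!mcoeff_neq0 mcoeff_toQ; apply: contraNneq => ->.
by rewrite rmorph0.
Qed.

Lemma toQ_is_multiplicative : GRing.monoid_morphism toQ.
Proof.
split=> [|P Q]; apply/malgP => m.
  by rewrite mcoeff_toQ !mcoeff1; case: eqP.
apply: etrans (esym (mcoeffMlw m (msupp_toQ P) (msupp_toQ Q))).
rewrite mcoeff_toQ; apply: etrans (congr1 intr (mcoeffMl P Q m)) _.
rewrite rmorph_sum; apply: eq_bigr => k _; rewrite rmorph_sum; apply: eq_bigr => l _.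
by rewrite rmorphMn rmorphM !mcoeff_toQ.
Qed.

HB.instance Definition _ := GRing.isZmodMorphism.Build (polyX int) (polyX rat) toQ toQ_is_additive.
HB.instance Definition _ := GRing.isMonoidMorphism.Build (polyX int) (polyX rat) toQ toQ_is_multiplicative.

Lemma L_ascents n :
  L_ n = \sum_(s : 'S_n.+1) run_monomial (@x_ int) (ascents s).
Proof.
case: n => [|n]; last exact: (@sum_run_structure (polyX int)).
(* At [n = 0] the only permutation has an empty ascent word, whose monomial is 1. *)
apply: esym; apply: etrans (eq_bigr (fun=> 1) _) _ => [s _|].
  exact: big_nil.
rewrite sumr_const card_Sn; exact: mulr1n.
Qed.

Lemma L_S n : L_ n.+1 = opD (L_ n) + 2 * x_ 1 * L_ n.
Proof.
rewrite !L_ascents.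
exact: (sum_run_monomialS n (@opD_is_additive int) (@opDM int) (@opDx int)).
Qed.

Lemma L_recurrence n :
  L_ n.+1 = \sum_(k < n.+1) (A_ k.+1 * L_ (n - k)) *+ (2 * 'C(n, k)).
Proof.
exact: (@derivation_recurrence (polyX int) (x_ 1) _ (@opD_is_additive int) (@opDM int) L_ erefl L_S).
Qed.

Lemma toQ_L_recurrence n : toQ (L_ n.+1) =
  \sum_(k < n.+1) (toQ (A_ k.+1) * toQ (L_ (n - k))) *+ (2 * 'C(n, k)).
Proof.
apply: etrans (congr1 toQ (L_recurrence n)) _.
apply: etrans (raddf_sum toQ _ _ _) _; apply: eq_bigr => k _.
by apply: etrans (raddfMn toQ _ _) _; congr (_ *+ _); exact: (rmorphM toQ).
Qed.

Theorem proposition7 :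
  (forall n : nat, (1 <= n)%N ->
     toQ (L_ n) =
     \sum_(p : intpart n)
       (2 ^+ size p / (sym_ord p)%:R * multinom p) *:
         \prod_(a <- p) toQ (A_ a))
  /\ calL =1 fps_exp (fps_scale 2 (fps_int calA)).
Proof.
have l0 : toQ (L_ 0) = 1 by exact: (rmorph1 toQ).
split=> [n _|].
  exact: (@partition_formula _ (fun a => toQ (A_ a)) (fun n => toQ (L_ n)) l0 toQ_L_recurrence n).
exact: (@exponential_formula _ (fun a => toQ (A_ a)) (fun n => toQ (L_ n)) l0 toQ_L_recurrence).
Qed.
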